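(* Let $(X,d,\mu)$ be a metric measure space with $\mu$ doubling, and let $\nu$ be a doubling measure on $X$. If $\nu$ satisfies condition (1), then $\nu$ satisfies condition (2) and condition (4).
   Context: $\mu,\nu$ are Borel measures giving positive finite measure to balls; doubling means $\mu(B(x,2r))\le c\,\mu(B(x,r))$ for all $x,r$. $\nu$ is a weighted measure with respect to $\mu$ if there exists $0\le\omega\in L^1_{loc}(X)$ with $\nu(A)=\int_A\omega\,d\mu$ for every $\mu$-measurable $A$. Condition (1): there are $0<\varepsilon,\delta<1$ such that for each ball $B$ and each measurable $E\subseteq B$, $\mu(E)\le\varepsilon\mu(B)$ implies $\nu(E)\le(1-\delta)\nu(B)$. Condition (2): there are constants $c>0$ and $p\ge1$ such that $\nu(E)\le c\,\nu(B)\big(\mu(E)/\mu(B)\big)^{1/p}$ for every ball $B$ and every measurable $E\subseteq B$. Condition (4): $\nu$ is a weighted measure with respect to $\mu$, and there are constants $c>0$, $p\ge1$ such that $\nu(E)\ge c\,\nu(B)\big(\mu(E)/\mu(B)\big)^{p}$ for every ball $B$ and every measurable $E\subseteq B$. *)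

(* Defs.v *)
From HB Require Import structures.
From mathcomp Require Import all_boot all_order all_algebra.
From mathcomp Require Import all_classical all_reals all_analysis.
Set Implicit Arguments. Unset Strict Implicit. Unset Printing Implicit Defensive.
Import Order.TTheory GRing.Theory Num.Theory.
Local Open Scope classical_set_scope.
Local Open Scope ring_scope.

(* Metric measure spaces: a measurable type T together with a metric
   [dist] whose open sets generate the sigma-algebra (Borel sets). *)

Definition dball {R : realType} {T : Type} (dist : T -> T -> R) (x : T) (r : R)
  : set T := [set y | dist x y < r].

Definition is_metric {R : realType} {T : Type} (dist : T -> T -> R) : Prop :=
  [/\ forall x y, 0 <= dist x y,
      forall x y, dist x y = 0 <-> x = y,
      forall x y, dist x y = dist y x &
      forall x y z, dist x z <= dist x y + dist y z].

Definition dopen {R : realType} {T : Type} (dist : T -> T -> R) (A : set T) : Prop :=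
  forall x, A x -> exists2 r : R, 0 < r & dball dist x r `<=` A.

Definition borel_for {R : realType} {d} {T : measurableType d}
  (dist : T -> T -> R) : Prop :=
  (@measurable d T) = <<s [set A | dopen dist A] >>.

Definition balls_pos_finite {R : realType} {d} {T : measurableType d}
  (dist : T -> T -> R) (mu : {measure set T -> \bar R}) : Prop :=
  forall x (r : R), 0 < r ->
    (0 < mu (dball dist x r))%E /\ (mu (dball dist x r) < +oo)%E.

Definition doubling {R : realType} {d} {T : measurableType d}
  (dist : T -> T -> R) (mu : {measure set T -> \bar R}) : Prop :=
  exists c : R, forall x (r : R), 0 < r ->
    (mu (dball dist x (2 * r)) <= c%:E * mu (dball dist x r))%E.

Definition condition1 {R : realType} {d} {T : measurableType d}
  (dist : T -> T -> R) (mu nu : {measure set T -> \bar R}) : Prop :=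
  exists eps delta : R, [/\ 0 < eps < 1, 0 < delta < 1 &
    forall x (r : R) (E : set T), 0 < r -> measurable E ->
      E `<=` dball dist x r ->
      (mu E <= eps%:E * mu (dball dist x r))%E ->
      (nu E <= (1 - delta)%:E * nu (dball dist x r))%E].

Definition condition2 {R : realType} {d} {T : measurableType d}
  (dist : T -> T -> R) (mu nu : {measure set T -> \bar R}) : Prop :=
  exists c p : R, [/\ 0 < c, 1 <= p &
    forall x (r : R) (E : set T), 0 < r -> measurable E ->
      E `<=` dball dist x r ->
      (nu E <= (c * fine (nu (dball dist x r)) *
                 (fine (mu E) / fine (mu (dball dist x r))) `^ (p^-1))%:E)%E].

Definition weighted_measure {R : realType} {d} {T : measurableType d}
  (dist : T -> T -> R) (mu nu : {measure set T -> \bar R}) : Prop :=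
  exists w : T -> R,
    [/\ forall x, 0 <= w x,
        measurable_fun setT w,
        (* w is locally integrable: integrable on every ball *)
        (forall x (r : R), 0 < r ->
           mu.-integrable (dball dist x r) (fun y => (w y)%:E)) &
        forall A, measurable A -> nu A = (\int[mu]_(y in A) (w y)%:E)%E].

Definition condition4 {R : realType} {d} {T : measurableType d}
  (dist : T -> T -> R) (mu nu : {measure set T -> \bar R}) : Prop :=
  weighted_measure dist mu nu /\
  exists c p : R, [/\ 0 < c, 1 <= p &
    forall x (r : R) (E : set T), 0 < r -> measurable E ->
      E `<=` dball dist x r ->
      ((c * fine (nu (dball dist x r)) *
        (fine (mu E) / fine (mu (dball dist x r))) `^ p)%:E <= nu E)%E].

(* Main.v *)
Require Import Defs.
From HB Require Import structures.
From mathcomp Require Import all_boot all_order all_algebra.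
From mathcomp Require Import all_classical all_reals all_analysis.
From mathcomp Require Import measurable_realfun ring lra.
Import Order.TTheory GRing.Theory Num.Theory.
Local Open Scope classical_set_scope.
Local Open Scope ring_scope.

(* Condition (1) is symmetric in the two measures, so the lower bound of (4) for
   the pair [nu, mu] is the upper bound of (2) for the pair [mu, nu]; (2) makes
   [nu] absolutely continuous and Radon-Nikodym provides the weight.
   For the lower bound, outer regularity reduces to an open set [E] in a ball.
   Call a ball thick when [E] fills all but a fraction [eps] of its [mu]-measure:
   condition (1) says that [nu E] then controls the [nu]-measure of the ball.
   If no ball of radius [rho] centred in [E] is thick, let [r_x] be the largest
   dyadic fraction of [rho] for which the ball at [x] is thick. By the 5r-covering
   lemma, the union of the balls of radii [2 r_x] has [mu]-measure larger than
   that of [E] by a fixed factor, while its [nu]-measure is comparable to [nu E].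
   Iterating with [rho] halved at each step keeps the sets in a fixed ball, so
   the process meets a thick ball within about log (mu B / mu E) steps; all
   losses are geometric in the number of steps, whence the power of
   [mu E / mu B]. *)

(** * Disjoint families of measurable sets: countability and comparison of unions *)

Section disjoint_families.
Context (R : realType) (d : measure_display) (T : measurableType d).
Variable m : {measure set T -> \bar R}.
Local Open Scope ereal_scope.

(** For each [n] only finitely many members have measure above [1/(n+1)]: more than [(n+1) * m H]
    disjoint ones would together exceed [m H]. This makes the Vitali families below countable. *)
Lemma countable_disjoint_positive (I : pointedType) (D : set I)
    (G : I -> set T) (H : set T) :
  measurable H -> m H < +oo -> (forall i, D i -> measurable (G i)) ->
  (forall i, D i -> G i `<=` H) -> (forall i, D i -> 0 < m (G i)) ->
  trivIset D G -> countable D.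
Proof.
move=> mH Hoo mG GH G0 tG.
have Hfin : m H \is a fin_num by rewrite ge0_fin_numE.
pose Dn (n : nat) := [set i | D i /\ (n.+1%:R^-1)%:E < m (G i)].
have -> : D = \bigcup_n Dn n.
  apply/seteqP; split=> [i Di|i [n _ []]//].
  have Goo : m (G i) < +oo.
    by apply: le_lt_trans Hoo; apply: le_measure; rewrite ?inE//;
      [exact: mG | exact: GH].
  have Gfin : m (G i) \is a fin_num by rewrite ge0_fin_numE.
  have G0' : (0 < fine (m (G i)))%R by rewrite fine_gt0// G0.
  exists (Num.truncn (fine (m (G i)))^-1) => //; split=> //.
  rewrite -(fineK Gfin) lte_fin invf_plt ?posrE ?ltr0n//.
  exact: truncnS_gt.
apply: bigcup_countable => // n _; apply: finite_set_countable.
apply: contrapT => /infiniteP/pcard_leP[f].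
have Df k : Dn n (f k) by apply: funS.
pose N := (Num.truncn (n.+1%:R * fine (m H))).+1.
have mGf k : measurable (G (f k)) by apply: mG; case: (Df k).
have tGf : trivIset [set: 'I_N] (fun k : 'I_N => G (f k)).
  apply/trivIsetP => i j _ _ ij.
  move/trivIsetP: tG; apply; [by case: (Df i)|by case: (Df j)|].
  apply: contra_neq ij => fij.
  by apply: val_inj; apply: (@inj _ _ _ f); rewrite ?inE.
have GfH : m (\big[setU/set0]_(i < N) G (f i)) <= m H.
  apply: le_measure; rewrite ?inE//; first exact: bigsetU_measurable.
  apply: subset_trans (@bigsetU_bigcup _ (fun k => G (f k)) N) _ => x [k _].
  by apply: GH; case: (Df k).
move: GfH; rewrite (measure_bigsetU_ord _ xpredT (fun k => mGf k) tGf).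
apply/negP; rewrite -ltNge.
apply: (@lt_le_trans _ _ (\sum_(i < N) (n.+1%:R^-1)%:E)); last first.
  by apply: lee_sum => i _; case: (Df i) => _ /ltW.
rewrite sumEFin big_const_ord iter_addr addr0 -(fineK Hfin) lte_fin.
by rewrite -[ltRHS]mulr_natl ltr_pdivlMr ?ltr0n// mulrC; exact: truncnS_gt.
Qed.

(** Subadditivity on the [F i], then additivity on the disjoint [G i]. In use, the [F i] are
    enlarged balls of a covering and the [G i] are disjoint pieces of the original balls. *)
Lemma measure_bigcup_le_disjoint (I : Type) (D : set I) (F G : I -> set T)
    (H : set T) (K : R) :
  countable D -> measurable H -> (0 <= K)%R ->
  (forall i, D i -> measurable (F i)) -> (forall i, D i -> measurable (G i)) ->
  (forall i, D i -> G i `<=` H) -> trivIset D G ->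
  (forall i, D i -> m (F i) <= K%:E * m (G i)) ->
  m (\bigcup_(i in D) F i) <= K%:E * m H.
Proof.
move=> /countable_injP[f injf] mH K0 mF mG GH tG FG.
(* Both families are carried to [nat] along the injection [f]; an index outside its image receives
   the empty set. *)
pose fib n := [set i | D i /\ f i = n].
pose pad (A : I -> set T) n := \bigcup_(i in fib n) A i.
have padE A i : D i -> pad A (f i) = A i.
  move=> Di; rewrite /pad (_ : fib (f i) = [set i]) ?bigcup_set1//.
  apply/seteqP; split=> [j [Dj fij]|j ->//].
  by apply: injf; rewrite ?inE.
have pad0 A n : ~ (exists2 i, D i & f i = n) -> pad A n = set0.
  move=> nn; apply: bigcup0 => i [Di fi]; exfalso; apply: nn; by exists i.
have mpad A : (forall i, D i -> measurable (A i)) ->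
    forall n, measurable (pad A n).
  move=> mA n; have [[i Di <-]|nn] := pselect (exists2 i, D i & f i = n).
    by rewrite padE//; exact: mA.
  by rewrite pad0.
have -> : \bigcup_(i in D) F i = \bigcup_n pad F n.
  apply/seteqP; split=> [x [i Di Fx]|x [n _ [i [Di _] Fx]]]; last by exists i.
  by exists (f i) => //; rewrite padE.
apply: (le_trans (generalized_Boole_inequality _ (mpad _ mF)
  (bigcupT_measurable _ (mpad _ mF)))).
apply: (@le_trans _ _ (\sum_(0 <= n <oo) (K%:E * m (pad G n)))).
  apply: lee_nneseries => [n _ _|n _]; first exact: measure_ge0.
  have [[i Di <-]|nn] := pselect (exists2 i, D i & f i = n).
    by rewrite !padE//; exact: FG.
  by rewrite !pad0// measure0 mule0.
rewrite nneseriesZl//; apply: lee_wpmul2l; first by rewrite lee_fin.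
rewrite -measure_semi_bigcup//.
- apply: le_measure; rewrite ?inE//.
    by apply: bigcupT_measurable; exact: mpad.
  by move=> x [n _ [i [Di _] Gx]]; exact: (GH i).
- exact: mpad.
- move=> n k _ _ [x [[i [Di <-] Gi] [j [Dj <-] Gj]]].
  by congr f; apply: tG => //; exists x.
- by apply: bigcupT_measurable; exact: mpad.
Qed.

End disjoint_families.

(** * Metric balls and the 5r-covering lemma *)

Section metric_balls.
Context (R : realType) (T : Type) (dist : T -> T -> R).
Hypothesis dist_metric : is_metric dist.

Local Notation B := (dball dist).

Lemma dist_self x : dist x x = 0.
Proof. by case: dist_metric => _ /(_ x x)[_ ->]. Qed.

Lemma dball_center x r : 0 < r -> B x r x.
Proof. by rewrite /dball/= dist_self. Qed.

Lemma le_dball x r s : r <= s -> B x r `<=` B x s.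
Proof. by move=> rs y; rewrite /dball/=; move=> /lt_le_trans; apply. Qed.

Lemma dball_sub_dball x y r s : dist x y + r <= s -> B y r `<=` B x s.
Proof.
case: dist_metric => _ _ _ tri xyrs z; rewrite /dball/= => yz.
by have := tri x y z; lra.
Qed.

Lemma dopen_dball x r : dopen dist (B x r).
Proof.
move=> y xy; exists (r - dist x y); first by move: xy; rewrite /dball/=; lra.
by apply: dball_sub_dball; lra.
Qed.

Lemma dopen_bigcup (I : Type) (D : set I) (F : I -> set T) :
  (forall i, D i -> dopen dist (F i)) -> dopen dist (\bigcup_(i in D) F i).
Proof.
move=> oF x [i Di Fx]; have [r r0 rF] := oF i Di x Fx; exists r => //.
by move=> y /rF Fy; exists i.
Qed.

Lemma dopenI (A C : set T) : dopen dist A -> dopen dist C -> dopen dist (A `&` C).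
Proof.
move=> oA oC x [/oA[r r0 rA] /oC[s s0 sC]].
exists (Num.min r s); first by rewrite lt_min r0.
move=> y xy; split; [apply: rA|apply: sC].
  by apply: le_dball xy; rewrite ge_min lexx.
by apply: le_dball xy; rewrite ge_min lexx orbT.
Qed.

Lemma dopenT : dopen dist setT.
Proof. by move=> x _; exists 1. Qed.

(** Every ball meets a chosen ball with at least half its radius, so its points lie within
    [2 * rad x + rad y <= 5 * rad y] of the chosen centre. The family comes from Zorn's lemma, and
    the bound [rho] makes a supremum of radii available. *)
Lemma vitali_5r (S : set T) (rad : T -> R) (rho : R) :
  (forall x, S x -> 0 < rad x) -> (forall x, S x -> rad x <= rho) ->
  exists D : set T, [/\ D `<=` S, trivIset D (fun x => B x (rad x)) &
    forall x, S x -> exists2 y, D y & B x (rad x) `<=` B y (5 * rad y)].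
Proof.
move=> rad0 radrho.
pose meets x y := B x (rad x) `&` B y (rad y) !=set0.
(* Families admissible in the sense that whatever meets the family meets
   a ball of comparable size: the maximal ones cannot be avoided. *)
pose P := [set D : set T | [/\ D `<=` S, trivIset D (fun x => B x (rad x)) &
  forall x y, S x -> D y -> meets x y ->
    exists z, [/\ D z, meets x z & rad x <= 2 * rad z]]].
have [D [[DS tD domD] maxD]] : exists D, P D /\ forall C, D `<` C -> ~ P C.
  apply: Zorn_bigcup => F FP totF; split.
  - by move=> x [A FA Ax]; have [+ _ _] := FP A FA; apply.
  - move=> x y [A FA Ax] [C FC Cy]; case: (totF A C FA FC) => AC.
      by have [_ + _] := FP C FC; apply => //; exact: AC.
    by have [_ + _] := FP A FA; apply => //; exact: AC.
  - move=> x y Sx [A FA Ay] xy; have [_ _ /(_ x y Sx Ay xy)[z [Az xz rz]]] := FP A FA.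
    by exists z; split=> //; exists A.
exists D; split=> // x Sx.
suff [y Dy xy] : exists2 y, D y & meets x y.
  have [z [Dz [w [xw zw]] rxz]] := domD x y Sx Dy xy.
  exists z => //; apply: dball_sub_dball.
  case: dist_metric => _ _ sym tri; move: xw zw; rewrite /dball/=.
  by have := tri z w x; rewrite (sym w x); lra.
apply: contrapT => nx.
(* Among the balls missing the whole family, one has radius above half the supremum of their radii;
   adjoining it keeps the family admissible, against maximality. *)
pose avoid := [set z | S z /\ forall y, D y -> ~ meets z y].
have avx : avoid x by split=> // y Dy xy; apply: nx; exists y.
have [z [Sz avz] zmax] : exists2 z, avoid z &
    forall w, avoid w -> rad w <= 2 * rad z.
  pose E := rad @` avoid.
  have supE : has_sup E.
    split; first by exists (rad x), x.
    by exists rho => _ [w [Sw _] <-]; exact: radrho.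
  have E0 : 0 < sup E.
    apply: (lt_le_trans (rad0 x Sx)); apply: sup_upper_bound => //.
    by exists x.
  have [_ [z avz <-] zE] := @sup_adherent _ _ (sup E / 2) (divr_gt0 E0 (ltr0Sn R 1)) supE.
  exists z => // w avw; suff : rad w <= sup E by lra.
  by apply: sup_upper_bound => //; exists w.
have zz : meets z z by exists z; split; apply: dball_center; exact: rad0.
apply: (maxD (z |` D)).
  split; first exact: subsetUr.
  by move=> /(_ z (or_introl erefl)) Dz; exact: (avz z Dz).
split.
- by move=> w [->//|]; exact: DS.
- move=> u v [->|Du] [->|Dv] uv //; [exfalso|exfalso|exact: tD].
    exact: avz Dv uv.
  by apply: avz Du _; rewrite /meets setIC.
- move=> u v Su zDv uv.
  have [[w Dw uw]|nu] := pselect (exists2 w, D w & meets u w).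
    have [w' [Dw' uw' rw']] := domD u w Su Dw uw.
    by exists w'; split=> //; right.
  case: zDv uv => [->|Dv] uv; last by exfalso; apply: nu; exists v.
  exists z; split=> //; first by left.
  by apply: zmax; split=> // y Dy uy; apply: nu; exists y.
Qed.

End metric_balls.

(** * Outer regularity of Borel measures inside an open set of finite measure *)

Section outer_regularity.
Context (R : realType) (d : measure_display) (T : measurableType d).
Context (dist : T -> T -> R).
Hypotheses (dist_metric : is_metric dist) (dist_borel : borel_for dist).

Lemma dopen_measurable (A : set T) : dopen dist A -> measurable A.
Proof.
by move=> oA; rewrite (_ : measurable A = <<s dopen dist >> A);
  [exact: sub_sigma_algebra | rewrite -[in RHS]dist_borel].
Qed.

Lemma dball_measurable x r : measurable (dball dist x r).
Proof. by apply: dopen_measurable; exact: dopen_dball. Qed.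

Variables (m : {measure set T -> \bar R}) (C : set T).
Hypotheses (openC : dopen dist C) (finC : (m C < +oo)%E).

(* Both [A] and its complement have open neighbourhoods overlapping little
   inside [C]; this symmetric form of regularity is stable by complement. *)
Let regular (A : set T) := forall e : R, 0 < e -> exists U V : set T,
  [/\ dopen dist U, dopen dist V, A `<=` U, ~` A `<=` V &
      (m (C `&` (U `&` V)) <= e%:E)%E].

Let small_of_decreasing (F : (set T)^nat) (e : R) :
  (forall n, measurable (F n)) ->
  (forall n k, (n <= k)%N -> F k `<=` F n) -> (m (F 0%N) < +oo)%E ->
  (m (\bigcap_n F n) < e%:E)%E -> exists n, (m (F n) <= e%:E)%E.
Proof.
move=> mF dF F0 Fe; apply: contrapT => nF.
have dF' : {homo F : n k / (n <= k)%N >-> (k <= n)%O}.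
  by move=> n k nk; apply/subsetPset; exact: dF.
have := nonincreasing_cvg_mu F0 mF (bigcapT_measurable mF) dF'.
have eF : \forall n \near \oo, (e%:E <= (m \o F) n)%E.
  by near=> n; rewrite leNgt; apply/negP => /ltW Fn; apply: nF; exists n.
by move=> /(cvge_ge eF); rewrite leNgt Fe.
Unshelve. all: by end_near. Qed.

(** The open [1/(n+1)]-neighbourhoods [V n] of the complement meet [A] in sets decreasing to the
    empty set, because [A] is open; continuity from above then applies inside [C]. *)
Let regular_open (A : set T) : dopen dist A -> regular A.
Proof.
move=> oA e e0.
pose V (n : nat) := \bigcup_(z in ~` A) dball dist z (n.+1%:R^-1).
have oV n : dopen dist (V n) by apply: dopen_bigcup => z _; exact: dopen_dball.
have mW n : measurable (C `&` (A `&` V n)).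
  by apply: dopen_measurable; do 2 apply: dopenI => //.
have [|||n Vn] := @small_of_decreasing (fun n => C `&` (A `&` V n)) e mW.
- move=> n k nk x [Cx [Ax [z Az zx]]]; split=> //; split=> //; exists z => //.
  by apply: le_dball zx; rewrite lef_pV2 ?posrE ?ltr0n// ler_nat.
- apply: le_lt_trans finC; apply: le_measure; rewrite ?inE//.
  exact: dopen_measurable.
- rewrite (_ : \bigcap_n _ = set0) ?measure0 ?lte_fin//.
  apply/seteqP; split=> // x WX; have [_ [Ax _]] := WX 0%N I.
  have [r r0 rA] := oA x Ax.
  have [_ [_ [z nAz zx]]] := WX (Num.truncn r^-1) I.
  apply: nAz; apply: rA; case: dist_metric => _ _ sym _.
  rewrite /dball/= sym; apply: (lt_trans zx).
  by rewrite invf_plt ?posrE ?ltr0n//; exact: truncnS_gt.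
exists A, (V n); split=> //.
by move=> x nAx; exists x => //; apply: dball_center => //; rewrite invr_gt0.
Qed.

(** Complementation exchanges [U] and [V]. For a union, the intersection of all [V n] may fail to be
    open, so it is cut to a finite intersection [VV k], with [k] given by continuity from above. *)
Let regular_sigma_algebra : sigma_algebra setT regular.
Proof.
split.
- by apply: regular_open => x [].
- move=> A rA e /rA[U [V [oU oV AU AV UV]]]; exists V, U; split=> //.
  + by rewrite setTD.
  + by rewrite setTD setCK.
  + by rewrite (setIC V).
- move=> A rA e e0.
  (* These errors sum to at most [e / 2], which leaves the strict inequality that
     [small_of_decreasing] requires. *)
  have e2 n : 0 < e / 2 / (2 ^ n.+1)%:R.
    by rewrite !divr_gt0// ltr0n expn_gt0.
  have /choice[U /choice[V UV]] := fun n => rA n _ (e2 n).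
  have oU n : dopen dist (U n) by case: (UV n).
  have oV n : dopen dist (V n) by case: (UV n).
  pose UU := \bigcup_n U n.
  pose VV k := \bigcap_(n < k) V n.
  have oUU : dopen dist UU by apply: dopen_bigcup.
  have oVV k : dopen dist (VV k).
    elim: k => [|k IH]; first by rewrite /VV bigcap_mkord big_ord0; exact: dopenT.
    rewrite /VV bigcap_mkord big_ord_recr/= -bigcap_mkord.
    exact: dopenI.
  have mW n : measurable (C `&` (UU `&` VV n)).
    by apply: dopen_measurable; do 2 apply: dopenI => //.
  have mUV n : measurable (C `&` (U n `&` V n)).
    by apply: dopen_measurable; do 2 apply: dopenI => //.
  have [|||k Vk] := @small_of_decreasing (fun n => C `&` (UU `&` VV n)) e mW.
  + move=> n k nk x [Cx [Ux Vx]]; split=> //; split=> // i/= ik.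
    by apply: Vx => /=; exact: leq_trans ik nk.
  + apply: le_lt_trans finC; apply: le_measure; rewrite ?inE//.
    exact: dopen_measurable.
  + apply: (@le_lt_trans _ _ (e / 2)%:E); last by rewrite lte_fin; lra.
    apply: (le_trans _ (@epsilon_trick0 _ (e / 2) xpredT _)); last lra.
    apply: (@le_trans _ _ (\sum_(0 <= n <oo) m (C `&` (U n `&` V n)))%E).
      apply: measure_sigma_subadditive => //; first exact: bigcapT_measurable.
      move=> x WX; have [Cx [[n _ Unx] _]] := WX 0%N I; exists n => //.
      (* [VV n] involves only indices below [n], so membership in [V n] is read off from
         [VV n.+1]. *)
      split=> //; split=> //; have [_ [_ +]] := WX n.+1 I; apply.
      by rewrite /=.
    apply: lee_nneseries => [n _ _|n _]; first exact: measure_ge0.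
    by case: (UV n).
  exists UU, (VV k); split=> //.
  + by move=> x [n _ Ax]; exists n => //; case: (UV n) => _ _ + _ _; apply.
  + move=> x nAx n _; case: (UV n) => _ _ _ + _; apply => Ax.
    by apply: nAx; exists n.
Qed.

(** The part of [C] in [U] but outside [A] lies in the overlap of [U] and [V], which is small by
    regularity. *)
Lemma outer_regular (A : set T) (e : R) : measurable A -> A `<=` C -> 0 < e ->
  exists U : set T, [/\ dopen dist U, A `<=` U, U `<=` C &
    (m U <= m A + e%:E)%E].
Proof.
move=> mA AC e0.
have regA : regular A.
  have : <<s dopen dist >> A by rewrite -[X in X A]dist_borel.
  apply: (smallest_sub regular_sigma_algebra) => B oB.
  exact: regular_open.
have [U [V [oU oV AU AV UV]]] := regA e e0.
have mU := dopen_measurable _ oU.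
have mC := dopen_measurable _ openC.
exists (C `&` U); split=> //.
- exact: dopenI.
- by move=> x Ax; split; [exact: AC|exact: AU].
rewrite (measureDI m (measurableI _ _ mC mU) mA) addeC; apply: leeD.
  by apply: le_measure; rewrite ?inE//; do 2?apply: measurableI.
apply: le_trans UV; apply: le_measure; rewrite ?inE.
- by apply: measurableD => //; exact: measurableI.
- by apply: dopen_measurable; do 2 apply: dopenI => //.
- by move=> x [[Cx Ux] nAx]; split=> //; split=> //; exact: AV.
Qed.

End outer_regularity.

(** * Iterated doubling, growth of open sets, and the power lower bound *)

Lemma doubling_iter (R : realType) (d : measure_display) (T : measurableType d)
    (dist : T -> T -> R) (m : {measure set T -> \bar R}) : doubling dist m ->
  exists2 C : R, 1 <= C & forall n x r, 0 < r ->
    (m (dball dist x (2 ^+ n * r)) <= (C ^+ n)%:E * m (dball dist x r))%E.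
Proof.
move=> [c dbl]; exists (Num.max 1 c); first by rewrite le_max lexx.
set C := Num.max 1 c; have C1 : 1 <= C by rewrite /C le_max lexx.
elim=> [x r _|n IH x r r0]; first by rewrite !expr0 mul1r mul1e.
rewrite exprS -mulrA; apply: (le_trans (dbl x _ _)).
  by rewrite mulr_gt0// exprn_gt0.
apply: (@le_trans _ _ (C%:E * m (dball dist x (2 ^+ n * r)))%E).
  by apply: lee_wpmul2r; rewrite ?measure_ge0// lee_fin /C le_max lexx orbT.
rewrite exprS EFinM -muleA; apply: lee_wpmul2l; last exact: IH.
by rewrite lee_fin; exact: le_trans C1.
Qed.

Section growth.
Context (R : realType) (d : measure_display) (T : measurableType d).
Context (dist : T -> T -> R).
Hypotheses (dist_metric : is_metric dist) (dist_borel : borel_for dist).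
Variables mu nu : {measure set T -> \bar R}.
Hypotheses (mu_balls : balls_pos_finite dist mu).
Hypotheses (nu_balls : balls_pos_finite dist nu).
Variables (eps delta Cm Cn : R).
Hypotheses (eps01 : 0 < eps < 1) (delta01 : 0 < delta < 1).
Hypotheses (Cm1 : 1 <= Cm) (Cn1 : 1 <= Cn).
Local Notation B := (dball dist).
Local Open Scope ereal_scope.
Hypothesis mu_dbl : forall n x (r : R), (0 < r)%R ->
  mu (B x (2 ^+ n * r)) <= (Cm ^+ n)%:E * mu (B x r).
Hypothesis nu_dbl : forall n x (r : R), (0 < r)%R ->
  nu (B x (2 ^+ n * r)) <= (Cn ^+ n)%:E * nu (B x r).
Hypothesis mu_small : forall x (r : R) (E : set T), (0 < r)%R -> measurable E ->
  E `<=` B x r -> mu E <= eps%:E * mu (B x r) ->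
  nu E <= (1 - delta)%:E * nu (B x r).

Let mB x r : measurable (B x r). Proof. exact: dball_measurable. Qed.
Let eps0 : (0 < eps)%R. Proof. by case/andP: eps01. Qed.
Let delta0 : (0 < delta)%R. Proof. by case/andP: delta01. Qed.
Let Cm0 : (0 < Cm)%R. Proof. exact: lt_le_trans Cm1. Qed.
Let Cn0 : (0 < Cn)%R. Proof. exact: lt_le_trans Cn1. Qed.

(** Relative gain in [mu] of one growth step: [eps] comes from non-thickness, [Cm ^+ 3] from
    enlarging balls by 8, the power of 2 that dominates the 5 of the covering lemma. *)
Let eta : R := (eps / Cm ^+ 3)%R.
(** Loss in [nu] of one growth step: [delta] comes from thickness at half the radius, and enlarging
    that half ball to 8 full radii is a factor [2 ^+ 4]. *)
Let A : R := (Cn ^+ 4 / delta)%R.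

Let eta0 : (0 < eta)%R. Proof. by rewrite divr_gt0// exprn_gt0. Qed.

Let A1 : (1 <= A)%R.
Proof.
rewrite ler_pdivlMr// mul1r; case/andP: delta01 => _ /ltW /le_trans; apply.
exact: exprn_ege1.
Qed.

Let thick (E : set T) x r := mu (B x r `\` E) <= eps%:E * mu (B x r).

(** Condition (1), applied to the part of the ball outside [E], leaves a fraction at least [delta]
    of its [nu]-measure to [E]. *)
Lemma nu_ge_of_thick E x r : (0 < r)%R -> measurable E -> thick E x r ->
  nu (B x r) <= delta^-1%:E * nu (E `&` B x r).
Proof.
move=> r0 mE dE.
have mBE := measurableD (mB x r) mE.
have /(_ r0 mBE) := @mu_small x r (B x r `\` E).
move=> /(_ (@subDsetl _ _ _) dE).
have [_ fB] := nu_balls x _ r0.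
have finS S : measurable S -> S `<=` B x r -> nu S \is a fin_num.
  move=> mS SB; rewrite ge0_fin_numE//; apply: le_lt_trans fB.
  by apply: le_measure; rewrite ?inE.
have : nu (B x r) = nu (B x r `\` E) + nu (E `&` B x r).
  by rewrite (measureDI nu (mB x r) mE) setIC.
rewrite -(fineK (finS _ mBE (@subDsetl _ _ _))).
rewrite -(fineK (finS _ (measurableI _ _ mE (mB x r)) (@subIsetr _ _ _))).
rewrite -(fineK (finS _ (mB x r) (@subset_refl _ _))).
rewrite -EFinD => -[BE]; rewrite -!EFinM !lee_fin.
rewrite ler_pdivlMl// => h; nra.
Qed.

(** Each ball is taken at the last dyadic radius before it becomes thick. Not being thick there, it
    brings new [mu]-mass outside [E]; its half, being thick, bounds its [nu]-measure by that of
    [E]. *)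
Lemma growth_step (E : set T) x0 (s rho : R) : (0 < rho)%R -> dopen dist E ->
  E `<=` B x0 s -> (forall x, E x -> ~ thick E x rho) ->
  exists E1 : set T, [/\ dopen dist E1, E1 `<=` B x0 (s + rho),
    (1 + eta)%:E * mu E <= mu E1 & nu E1 <= A%:E * nu E].
Proof.
move=> rho0 oE Es nE.
have mE : measurable E by exact: dopen_measurable oE.
(* A thick radius exists because [E] is open and contains small balls. The first thick exponent is
   nonzero since [rho] is not thick, and [j] is its predecessor; outside [E] the value is a
   dummy. *)
have /choice[j jP] : forall x, exists j, E x ->
    ~ thick E x (rho / 2 ^+ j) /\ thick E x (rho / 2 ^+ j / 2).
  move=> x; have [Ex|nEx] := pselect (E x); last by exists 0%N.
  have [r r0 rE] := oE x Ex.
  have exd : exists j, `[< thick E x (rho / 2 ^+ j) >].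
    have [k kP] : exists k, (rho / r < 2 ^+ k)%R.
      exists (Num.truncn (rho / r)).+1; apply: (lt_trans (truncnS_gt _)).
      by rewrite -natrX ltr_nat ltn_expl.
    exists k; apply/asboolP; rewrite /thick (_ : _ `\` _ = set0).
      by rewrite measure0 mule_ge0// lee_fin ltW.
    apply/seteqP; split=> // y [yB]; apply; apply: rE; apply: le_dball yB.
    rewrite ler_pdivrMr ?exprn_gt0// mulrC -ler_pdivrMr//; exact: ltW.
  case: (ex_minnP exd) => -[|k] /asboolP kd kmin.
    by exfalso; apply: (nE x Ex); move: kd; rewrite expr0 divr1.
  exists k => _; split; last by rewrite -mulrA -invfM -exprSr.
  by move=> /asboolP /kmin; rewrite ltnn.
pose rad x := (rho / 2 ^+ j x)%R.
have rad0 x : (0 < rad x)%R by rewrite divr_gt0// exprn_gt0.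
have radrho x : (rad x <= rho)%R.
  by rewrite ler_pdivrMr ?exprn_gt0// ler_pMr// exprn_ege1// ler1n.
have [D [DE tD cD]] :=
  vitali_5r _ _ _ dist_metric _ _ _ (fun x (_ : E x) => rad0 x) (fun x (_ : E x) => radrho x).
pose E1 := \bigcup_(x in E) B x (rad x).
have oE1 : dopen dist E1 by apply: dopen_bigcup => x _; exact: dopen_dball.
have mE1 : measurable E1 by exact: dopen_measurable oE1.
have E1s : E1 `<=` B x0 (s + rho).
  move=> y [x Ex]; apply: dball_sub_dball => //.
  by have := Es x Ex; have := radrho x; rewrite /dball/=; lra.
have EE1 : E `<=` E1 by move=> x Ex; exists x => //; exact: dball_center.
(* The empty case is separate: positivity of [s + rho] is deduced from a point of [D]. *)
have ctD : countable D.
  have [[x Dx]|D0] := pselect (D !=set0); last first.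
    by rewrite (_ : D = set0)//; apply/seteqP; split=> // x Dx; apply: D0; exists x.
  have sr0 : (0 < s + rho)%R.
    have := Es x (DE x Dx); case: dist_metric => d0 _ _ _.
    by have := d0 x0 x; rewrite /dball/=; lra.
  apply: (@countable_disjoint_positive _ _ _ mu _ D (fun x => B x (rad x))
    (B x0 (s + rho))) => //.
  - by case: (mu_balls x0 _ sr0).
  - by move=> y Dy; apply: subset_trans E1s => z yz; exists y => //; exact: DE.
  - by move=> y Dy; case: (mu_balls y _ (rad0 y)).
have mU : measurable (\bigcup_(y in D) B y (2 ^+ 3 * rad y)).
  by apply: (dopen_measurable _ _ _ dist) => //; apply: dopen_bigcup => y _; exact: dopen_dball.
have E1D : E1 `<=` \bigcup_(y in D) B y (2 ^+ 3 * rad y).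
  move=> z [x /cD[y Dy xy] /xy yz]; exists y => //; apply: le_dball yz.
  by rewrite ler_wpM2r ?ltW//; lra.
exists E1; split=> //; last first.
  apply: (@le_trans _ _ (nu (\bigcup_(y in D) B y (2 ^+ 3 * rad y)))).
    by apply: le_measure; rewrite ?inE.
  apply: (@measure_bigcup_le_disjoint _ _ _ _ _ D _
    (fun y => E `&` B y (rad y / 2))) => //.
  - exact: le_trans A1.
  - by move=> y _; exact: measurableI.
  - move=> y z Dy Dz [w [[_ yw] [_ zw]]]; apply: tD => //; exists w.
    by split; [apply: le_dball yw|apply: le_dball zw];
      rewrite ler_pdivrMr// ler_pMr//; lra.
  - move=> y Dy; have [_ dy] := jP y (DE y Dy).
    rewrite (_ : 2 ^+ 3 * rad y = 2 ^+ 4 * (rad y / 2))%R; last by field.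
    have r2 : (0 < rad y / 2)%R by rewrite divr_gt0.
    apply: (le_trans (nu_dbl _ _ _ r2)).
    rewrite /A (EFinM (Cn ^+ 4) delta^-1) -muleA; apply: lee_wpmul2l.
      by rewrite lee_fin exprn_ge0// ltW.
    exact: nu_ge_of_thick.
have K0 : (0 <= eta^-1)%R by rewrite invr_ge0 ltW.
(* The new mass is thus at least [eta * mu E1], hence at least [eta * mu E], and it adds to
   [mu E]. *)
have : mu E1 <= (eta^-1)%:E * mu (E1 `\` E).
  apply: (@le_trans _ _ (mu (\bigcup_(y in D) B y (2 ^+ 3 * rad y)))).
    by apply: le_measure; rewrite ?inE.
  apply: (@measure_bigcup_le_disjoint _ _ _ _ _ D _
    (fun y => B y (rad y) `\` E)) => //.
  - exact: measurableD.
  - by move=> y _; exact: measurableD.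
  - move=> y Dy; apply: setSD => z yz; exists y => //; exact: DE.
  - move=> y z Dy Dz [w [[yw _] [zw _]]]; apply: tD => //; exists w.
    by split.
  - move=> y Dy; have [ndy _] := jP y (DE y Dy).
    apply: (le_trans (mu_dbl _ _ _ (rad0 y))).
    rewrite /eta invf_div (EFinM (Cm ^+ 3) eps^-1) -muleA; apply: lee_wpmul2l.
      by rewrite lee_fin exprn_ge0// ltW.
    by move/negP: ndy; rewrite -ltNge => /ltW; rewrite lee_pdivlMl.
rewrite -lee_pdivrMl ?invr_gt0// invrK => h.
rewrite (measureDI mu mE1 mE) (setIidr EE1) EFinD ge0_muleDl ?lee_fin ?(ltW eta0)//.
rewrite mul1e addeC; apply: leeD => //.
apply: le_trans h; apply: lee_wpmul2l; first by rewrite lee_fin ltW.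
by apply: le_measure; rewrite ?inE.
Qed.

(** Halving [rho] keeps [s + 2 * rho] invariant when [s] becomes [s + rho], so all sets stay in one
    ball. Its [mu]-measure leaves no room for [n] growth steps, so a thick ball appears earlier,
    with radius at least [rho / 2 ^ n]. *)
Lemma growth_iter n x0 : forall (E : set T) (s rho : R), (0 < rho)%R ->
  dopen dist E -> E `<=` B x0 s ->
  mu (B x0 (s + 2 * rho)) < ((1 + eta) ^+ n)%:E * mu E ->
  exists2 y, B x0 (s + 2 * rho) y &
    nu (B y (rho / 2 ^+ n)) <= (delta^-1 * A ^+ n)%:E * nu E.
Proof.
have An0 k : (0 <= A ^+ k)%R by rewrite exprn_ge0//; exact: le_trans A1.
elim: n => [|n IH] E s rho rho0 oE Es muE;
  have mE : measurable E by exact: dopen_measurable oE.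
  exfalso; move: muE; rewrite expr0 mul1e; apply/negP; rewrite -leNgt.
  apply: le_measure; rewrite ?inE//; apply: (subset_trans Es).
  by apply: le_dball; lra.
have [[x Ex dx]|nE] := pselect (exists2 x, E x & thick E x rho).
  exists x; first by apply: le_dball (Es x Ex); lra.
  apply: (@le_trans _ _ (nu (B x rho))).
    apply: le_measure; rewrite ?inE//; apply: le_dball.
    by rewrite ler_pdivrMr ?exprn_gt0// ler_pMr// exprn_ege1// ler1n.
  apply: (le_trans (nu_ge_of_thick _ _ _ rho0 mE dx)); apply: lee_pmul.
  - by rewrite lee_fin invr_ge0 ltW.
  - exact: measure_ge0.
  - by rewrite lee_fin ler_pMr ?invr_gt0// exprn_ege1.
  - by apply: le_measure; rewrite ?inE//; exact: measurableI.
have [|E1 [oE1 E1s muE1 nuE1]] := growth_step E x0 s rho rho0 oE Es.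
  by move=> x Ex dx; apply: nE; exists x.
have r2 : (0 < rho / 2)%R by rewrite divr_gt0.
have sE : (s + rho + 2 * (rho / 2) = s + 2 * rho)%R by field.
have [|y yB nuy] := IH E1 (s + rho)%R (rho / 2)%R r2 oE1 E1s.
  rewrite sE; apply: (lt_le_trans muE).
  rewrite exprSr EFinM -muleA; apply: lee_wpmul2l => //.
  by rewrite lee_fin exprn_ge0// addr_ge0// ltW.
exists y; first by rewrite -sE.
rewrite exprS invfM mulrA; apply: (le_trans nuy).
rewrite exprSr mulrA (EFinM _ A) -muleA; apply: lee_wpmul2l => //.
by rewrite lee_fin mulr_ge0// invr_ge0 ltW.
Qed.

Lemma nu_lower_bound : exists (c : R) (p : nat), [/\ (0 < c)%R, (0 < p)%N &
  forall x (r : R) (E : set T), (0 < r)%R -> measurable E -> E `<=` B x r ->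
    (c * fine (nu (B x r)) * (fine (mu E) / fine (mu (B x r))) ^+ p)%:E <= nu E].
Proof.
have A0 : (0 < A)%R by exact: lt_le_trans A1.
have eta1 : (1 < 1 + eta)%R by rewrite ltrDl.
have eta10 : (0 < 1 + eta)%R by exact: lt_trans eta1.
have big (a : R) : exists n, (a < (1 + eta) ^+ n)%R.
  have bernoulli n : (n%:R * eta <= (1 + eta) ^+ n)%R.
    elim: n => [|n IH]; first by rewrite mul0r expr0.
    rewrite exprS -natr1 mulrDl mul1r [leRHS]mulrDl mul1r lerD// ler_pMr//.
    by rewrite exprn_ege1// ltW.
  exists (Num.truncn (a / eta)).+1; apply: lt_le_trans (bernoulli _).
  by rewrite -ltr_pdivrMr//; exact: truncnS_gt.
(* [Cn * A] is the loss per step, so [n] steps lose at most the [p]-th power of the growth factor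
   [(1 + eta) ^+ n]. *)
have [p pK] := big (Cn * A)%R.
have p0 : (0 < p)%N.
  by case: p pK => //; rewrite expr0 ltNge mulr_ege1.
pose c := (delta / (Cn ^+ 3 * (1 + eta) ^+ p * Cm ^+ p))%R.
have c0 : (0 < c)%R by rewrite divr_gt0// !mulr_gt0 ?exprn_gt0.
exists c, p; split=> // x r E r0 mE Er.
have [nuB0 nuBoo] := nu_balls x _ r0.
have [muB0 muBoo] := mu_balls x _ r0.
have fnuB : nu (B x r) \is a fin_num by rewrite ge0_fin_numE.
have fmuB : mu (B x r) \is a fin_num by rewrite ge0_fin_numE.
have b0 : (0 < fine (mu (B x r)))%R by rewrite fine_gt0 ?muB0.
have finmu S : measurable S -> S `<=` B x r -> mu S \is a fin_num.
  move=> mS SB; rewrite ge0_fin_numE//; apply: le_lt_trans muBoo.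
  by apply: le_measure; rewrite ?inE.
have main U : dopen dist U -> U `<=` B x r -> 0 < mu U ->
    (c * fine (nu (B x r)) * (fine (mu U) / fine (mu (B x r))) ^+ p)%:E <= nu U.
  move=> oU UB muU0.
  have mU : measurable U by exact: dopen_measurable oU.
  have fmuU := finmu U mU UB.
  have u0 : (0 < fine (mu U))%R by rewrite fine_gt0 ?muU0// -ge0_fin_numE.
  have ub : (fine (mu U) <= fine (mu (B x r)))%R.
    by rewrite fine_le//; apply: le_measure; rewrite ?inE.
  set t := (fine (mu U) / fine (mu (B x r)))%R.
  have t0 : (0 < t)%R by rewrite divr_gt0.
  have t1 : (t <= 1)%R by rewrite ler_pdivrMr// mul1r.
  (* The number of steps [n.+1] is least possible: it exceeds [Cm / t] to force a thick ball, while
     minimality bounds [(1 + eta) ^+ n] by [Cm / t]. It is not 0 because [t <= 1 <= Cm]. *)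
  case: (ex_minnP (big (Cm / t)%R)) => -[|n].
    by rewrite expr0 => + _; rewrite ltr_pdivrMr// mul1r => /lt_le_trans/(_ t1); rewrite ltNge Cm1.
  move=> nP /(_ n) nmin.
  have nle : ((1 + eta) ^+ n <= Cm / t)%R.
    by rewrite leNgt; apply/negP => /nmin; rewrite ltnn.
  have r2 : (0 < r / 2)%R by rewrite divr_gt0.
  have [|y yB nuy] := growth_iter n.+1 x U r (r / 2) r2 oU UB.
    rewrite (_ : r + 2 * (r / 2) = 2 ^+ 1 * r)%R; last by field.
    apply: (le_lt_trans (mu_dbl _ _ _ r0)); rewrite expr1.
    rewrite -(fineK fmuU) -(fineK fmuB) -!EFinM lte_fin.
    by move: nP; rewrite ltr_pdivrMr// /t mulrA ltr_pdivlMr.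
  have rn0 : (0 < r / 2 / 2 ^+ n.+1)%R by rewrite divr_gt0// exprn_gt0.
  have nuB : nu (B x r) <=
      (Cn ^+ (3 + n.+1) * (delta^-1 * A ^+ n.+1))%:E * nu U.
    (* This radius is [4 * r]; since [y] is within [2 * r] of [x], the ball contains [B x r]. *)
    apply: (@le_trans _ _ (nu (B y (2 ^+ (3 + n.+1) * (r / 2 / 2 ^+ n.+1))))).
      apply: le_measure; rewrite ?inE//; apply: dball_sub_dball => //.
      rewrite exprD (_ : 2 ^+ 3 * _ * _ = 4 * r)%R; last first.
        by field; rewrite expf_neq0.
      by case: dist_metric => _ _ sym _; rewrite sym;
        move: yB; rewrite /dball/=; lra.
    apply: (le_trans (nu_dbl _ _ _ rn0)).
    rewrite (EFinM (Cn ^+ _)) -muleA; apply: lee_wpmul2l => //.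
    by rewrite lee_fin exprn_ge0// ltW.
  have fnuU : nu U \is a fin_num.
    rewrite ge0_fin_numE//; apply: le_lt_trans nuBoo.
    by apply: le_measure; rewrite ?inE.
  move: nuB; rewrite -(fineK fnuU) -(fineK fnuB) -EFinM !lee_fin.
  set v := fine (nu (B x r)); set u := fine (nu U) => vu.
  have unn : (0 <= u)%R by rewrite fine_ge0.
  have KC : ((Cn * A) ^+ n.+1 <= (1 + eta) ^+ p * (Cm / t) ^+ p)%R.
    apply: (@le_trans _ _ (((1 + eta) ^+ p) ^+ n.+1)%R).
      apply: lerXn2r; last exact: ltW.
        by rewrite nnegrE mulr_ge0// ltW.
      by rewrite nnegrE exprn_ge0// ltW.
    rewrite exprAC exprS exprMn ler_wpM2l ?exprn_ge0 ?(ltW eta10)//.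
    apply: lerXn2r => //; rewrite nnegrE; first by rewrite exprn_ge0// ltW.
    by rewrite divr_ge0// ltW.
  have {vu} vu : (v <= Cn ^+ 3 / delta * ((1 + eta) ^+ p * (Cm / t) ^+ p) * u)%R.
    apply: (le_trans vu); rewrite ler_wpM2r//.
    rewrite (_ : Cn ^+ (3 + n.+1) * _ = Cn ^+ 3 / delta * (Cn * A) ^+ n.+1)%R.
      by rewrite ler_wpM2l// divr_ge0 ?exprn_ge0 ?(ltW Cn0) ?(ltW delta0).
    by rewrite exprD [((Cn * A) ^+ _)%R]exprMn; ring.
  rewrite /c; apply: (@le_trans _ _ (delta / (Cn ^+ 3 * (1 + eta) ^+ p * Cm ^+ p) *
    (Cn ^+ 3 / delta * ((1 + eta) ^+ p * (Cm / t) ^+ p) * u) * t ^+ p))%R.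
    by rewrite ler_wpM2r ?exprn_ge0 ?(ltW t0)// ler_wpM2l// ltW.
  rewrite exprMn exprVn le_eqVlt; apply/orP; left; apply/eqP; field.
  by rewrite !expf_neq0 ?gt_eqF.
have [muE0|muE0] := eqVneq (mu E) 0.
  by rewrite muE0 /= mul0r expr0n (gtn_eqF p0) mulr0 measure_ge0.
apply/lee_addgt0Pr => e e0.
(* Regularity is needed for [nu] only: passing to [U] can only increase [mu], which strengthens the
   lower bound. *)
have [U [oU EU UB nuU]] := outer_regular _ _ _ _ dist_metric dist_borel nu _
  (dopen_dball _ _ _ dist_metric x r) nuBoo E e mE Er e0.
have mU : measurable U by exact: dopen_measurable oU.
have EU' : mu E <= mu U by apply: le_measure; rewrite ?inE.
apply: le_trans nuU; apply: le_trans (main U oU UB _); last first.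
  by apply: lt_le_trans EU'; rewrite lt0e muE0 measure_ge0.
rewrite lee_fin; apply: ler_wpM2l.
  by rewrite mulr_ge0 ?fine_ge0// ltW.
apply: lerXn2r; rewrite ?nnegrE ?divr_ge0 ?fine_ge0//.
by apply: ler_wpM2r; rewrite ?invr_ge0 ?fine_ge0// fine_le ?finmu.
Qed.

End growth.

(** * The Radon-Nikodym weight *)

(** The space is cut into disjoint layers [S k] between concentric balls, where [nu] is finite; the
    densities of the restrictions of [nu] to the layers are glued. *)
Lemma weighted_measure_of_null (R : realType) (d : measure_display)
    (T : measurableType d) (dist : T -> T -> R)
    (mu nu : {measure set T -> \bar R}) :
  is_metric dist -> borel_for dist ->
  balls_pos_finite dist mu -> balls_pos_finite dist nu ->
  (forall x (r : R) A, 0 < r -> measurable A -> A `<=` dball dist x r ->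
    mu A = 0%E -> nu A = 0%E) ->
  weighted_measure dist mu nu.
Proof.
move=> dm db bmu bnu null.
pose F (n : nat) := dball dist point n.+1%:R.
have mF n : measurable (F n) by exact: dball_measurable.
have UF : \bigcup_n F n = setT.
  apply/seteqP; split=> // x _; exists (Num.truncn (dist point x)) => //.
  exact: truncnS_gt.
pose S := seqDU F.
have mS n : measurable (S n).
  by apply: measurableD => //; exact: bigsetU_measurable.
have US : \bigcup_n S n = setT by rewrite -UF [RHS]seqDU_bigcup_eq.
have tS := trivIset_seqDU F.
have nuS n : (nu (S n) < +oo)%E.
  have [_] := bnu point n.+1%:R (ltr0Sn _ _); apply: le_lt_trans.
  by apply: le_measure; rewrite ?inE //; [exact: mF|move=> y []].
have sf : sigma_finite setT mu.
  exists F => // n; split; first exact: mF.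
  by have [_ muF] := bmu point n.+1%:R (ltr0Sn _ _); exact: muF.
pose mu' : {sigma_finite_measure set T -> \bar R} :=
  HB.pack (Measure.sort mu)
    (isSFinite.Build _ _ _ _ (sfinite_measure_sigma_finite sf))
    (isSigmaFinite.Build _ _ _ _ sf).
pose nu_ k : {finite_measure set T -> \bar R} := mfrestr (mS k) (nuS k).
have dom k : nu_ k `<< mu'.
  apply/null_content_dominatesP => A mA muA.
  rewrite /nu_ /= /mfrestr /mrestr.
  apply: (null point k.+1%:R _ (ltr0Sn _ _)); first exact: measurableI.
    by move=> y [_ []].
  by apply: subset_measure0 muA => //; exact: measurableI.
pose f k := Radon_Nikodym_SigmaFinite.f (nu_ k) mu'.
have f0 k x : (0 <= f k x)%E by exact: Radon_Nikodym_SigmaFinite.f_ge0.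
have ffin k x : f k x \is a fin_num by exact: Radon_Nikodym_SigmaFinite.f_fin_num.
have mf k : measurable_fun setT (f k).
  by have /measurable_int := Radon_Nikodym_SigmaFinite.f_integrable (dom k).
pose g k := (f k) \_ (S k).
have g0 k x : (0 <= g k x)%E by rewrite /g patchE; case: ifP.
have mg k : measurable_fun setT (g k).
  by apply/(measurable_restrictT _ (mS k)); exact: measurable_funTS.
pose w x := fine (\sum_(0 <= k <oo) g k x)%E.
(* At each point only the term of its own layer can be nonzero, so the sum is finite and [fine]
   loses nothing. *)
have wE x : (w x)%:E = (\sum_(0 <= k <oo) g k x)%E.
  rewrite fineK//; have [k _ Skx] : (\bigcup_n S n) x by rewrite US.
  rewrite (@nneseriesD1 _ (fun i => g i x) k xpredT)//= eseries0 => [|i _ /=ik].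
    by rewrite adde0 /g patchE mem_set.
  rewrite /g patchE memNset// => Six; move/negP: ik; apply; apply/eqP.
  by apply: tS => //; exists x.
have w0 x : 0 <= w x by rewrite /w fine_ge0// nneseries_ge0.
have intw A : measurable A -> nu A = (\int[mu]_(y in A) (w y)%:E)%E.
  move=> mA.
  under eq_integral do rewrite wE.
  rewrite integral_nneseries//; last by move=> k; exact: measurable_funTS.
  rewrite -{1}(setIT A) -US setI_bigcupr measure_semi_bigcup//.
  - apply: eq_eseriesr => k _; rewrite /g -integral_mkcondr.
    rewrite -(Radon_Nikodym_SigmaFinite.f_integral (dom k)); last exact: measurableI.
    by rewrite /nu_ /= /mfrestr /mrestr -setIA setIid.
  - by move=> k; exact: measurableI.
  - exact: trivIset_setIl.
  - by apply: bigcupT_measurable => k; exact: measurableI.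
have mw : measurable_fun setT w.
  apply/measurable_EFinP; rewrite (_ : EFin \o w = fun x => \sum_(0 <= k <oo) g k x)%E.
    exact: ge0_emeasurable_sum.
  by apply/funext => x /=; exact: wE.
exists w; split=> // x r r0.
have mB := dball_measurable _ _ _ _ dm db x r.
apply/integrableP; split.
  by apply/measurable_EFinP; exact: measurable_funTS.
under eq_integral do rewrite gee0_abs ?lee_fin//.
by rewrite -intw//; case: (bnu x r r0).
Qed.

(* The complement in [B] of a set that is small for [mu] is not negligible for
   [nu]; contraposing exchanges the two measures, so condition (1) is symmetric. *)
Lemma condition1_sym (R : realType) (d : measure_display)
    (T : measurableType d) (dist : T -> T -> R)
    (mu nu : {measure set T -> \bar R}) :
  is_metric dist -> borel_for dist ->
  balls_pos_finite dist mu -> balls_pos_finite dist nu ->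
  condition1 dist mu nu -> condition1 dist nu mu.
Proof.
move=> dm db bmu bnu [eps [delta [eps01 delta01 small]]].
(* The contrapositive gives [nu E >= delta * nu B]; halving [delta] makes this strict. *)
exists (delta / 2), eps; split=> //; first by lra.
move=> x r E r0 mE EB; apply: contraPP => /negP; rewrite -ltNge => muE.
apply/negP; rewrite -ltNge.
have mB := dball_measurable _ _ _ _ dm db x r.
have mBE := measurableD mB mE.
have := small x r (dball dist x r `\` E) r0 mBE (@subDsetl _ _ _).
have split_fine (m : {measure set T -> \bar R}) : balls_pos_finite dist m ->
    [/\ 0 < fine (m (dball dist x r)),
        m (dball dist x r) = (fine (m (dball dist x r)))%:E,
        m E = (fine (m E))%:E &
        m (dball dist x r `\` E)
          = (fine (m (dball dist x r)) - fine (m E))%:E].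
  move=> bm; have [m0 moo] := bm x r r0.
  have fB : m (dball dist x r) \is a fin_num by rewrite ge0_fin_numE.
  have fE : m E \is a fin_num.
    rewrite ge0_fin_numE//; apply: le_lt_trans moo.
    by apply: le_measure; rewrite ?inE.
  split; rewrite ?fineK//; first by rewrite fine_gt0 ?m0.
  by rewrite measureD// (setIidr EB) EFinB !fineK.
have [muB0 muB muE' muD] := split_fine mu bmu.
have [nuB0 nuB nuE' nuD] := split_fine nu bnu.
move: muE; rewrite muD nuD muB nuB muE' nuE' -!EFinM !lee_fin !lte_fin => muE.
move=> /(_ _)/wrap[]; first by nra.
by nra.
Qed.

(** * From condition (1) to conditions (2) and (4) *)

(** Stated for a general pair because it serves twice: with the measures exchanged for (2), and in
    the given order for (4). *)
Lemma condition1_lower_bound (R : realType) (d : measure_display)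
    (T : measurableType d) (dist : T -> T -> R)
    (mu nu : {measure set T -> \bar R}) :
  is_metric dist -> borel_for dist ->
  balls_pos_finite dist mu -> doubling dist mu ->
  balls_pos_finite dist nu -> doubling dist nu ->
  condition1 dist mu nu ->
  exists (c : R) (p : nat), [/\ 0 < c, (0 < p)%N &
    forall x (r : R) (E : set T), 0 < r -> measurable E ->
      E `<=` dball dist x r ->
      ((c * fine (nu (dball dist x r)) *
        (fine (mu E) / fine (mu (dball dist x r))) ^+ p)%:E <= nu E)%E].
Proof.
move=> dm db bmu /doubling_iter[Cm Cm1 mudbl] bnu /doubling_iter[Cn Cn1 nudbl].
move=> [eps [delta [eps01 delta01 small]]].
exact: (@nu_lower_bound _ _ _ _ dm db _ _ bmu bnu eps delta Cm Cn).
Qed.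

Theorem theorem4p3 (R : realType) (d : measure_display) (T : measurableType d)
  (dist : T -> T -> R) (mu nu : {measure set T -> \bar R}) :
  is_metric dist -> borel_for dist ->
  balls_pos_finite dist mu -> doubling dist mu ->
  balls_pos_finite dist nu -> doubling dist nu ->
  condition1 dist mu nu ->
  condition2 dist mu nu /\ condition4 dist mu nu.
Proof.
move=> dm db bmu dmu bnu dnu c1.
have cond2 : condition2 dist mu nu.
  have [c [p [c0 p0 low]]] := condition1_lower_bound _ _ _ _ _ _ dm db bnu dnu bmu dmu
    (condition1_sym _ _ _ _ _ _ dm db bmu bnu c1).
  have pR0 : 0 < p%:R :> R by rewrite ltr0n.
  (* The [p]-th root of the exchanged bound [c * mu B * (nu E / nu B) ^+ p <= mu E]. *)
  exists (c^-1 `^ (p%:R^-1)), p%:R; split; [|by rewrite ler1n|].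
    by rewrite powR_gt0// invr_gt0.
  move=> x r E r0 mE EB.
  have [nuB0 nuBoo] := bnu x r r0; have [muB0 muBoo] := bmu x r r0.
  have mB := dball_measurable _ _ _ _ dm db x r.
  have fin (m : {measure set T -> \bar R}) :
      (m (dball dist x r) < +oo)%E -> m E \is a fin_num.
    move=> moo; rewrite ge0_fin_numE//; apply: le_lt_trans moo.
    by apply: le_measure; rewrite ?inE.
  have fnuE := fin nu nuBoo; have fmuE := fin mu muBoo.
  have := low x r E r0 mE EB.
  rewrite -(fineK fnuE) -(fineK fmuE) !lee_fin /=.
  have : 0 < fine (nu (dball dist x r)) by rewrite fine_gt0 ?nuB0.
  have : 0 < fine (mu (dball dist x r)) by rewrite fine_gt0 ?muB0.
  have : 0 <= fine (nu E) by rewrite fine_ge0.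
  have : 0 <= fine (mu E) by rewrite fine_ge0.
  move: (fine (nu E)) (fine (mu E)) => u v.
  move: (fine (nu _)) (fine (mu _)) => b a v0 u0 a0 b0 h.
  rewrite [c^-1 `^ _ * b]mulrC -mulrA -powRM ?invr_ge0 ?divr_ge0 ?(ltW c0) ?(ltW a0)//.
  rewrite -ler_pdivrMl// mulrC.
  have ub0 : 0 <= u / b by rewrite divr_ge0// ltW.
  have -> : u / b = ((u / b) ^+ p) `^ p%:R^-1.
    by rewrite -powR_mulrn// -powRrM mulfV ?powRr1// lt0r_neq0.
  apply: ge0_ler_powR.
  - by rewrite invr_ge0 ler0n.
  - by rewrite nnegrE exprn_ge0.
  - by rewrite nnegrE mulr_ge0 ?invr_ge0 ?divr_ge0// ltW.
  by rewrite ler_pdivlMl// ler_pdivlMr// mulrAC.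
split=> //; split.
  apply: weighted_measure_of_null => // x r A r0 mA AB muA.
  have [c [p [c0 p1 /(_ x r A r0 mA AB)]]] := cond2.
  (* Absolute continuity: the power of 0 vanishes since its exponent [p^-1] is nonzero. *)
  rewrite muA /= mul0r powR0 ?mulr0 ?invr_eq0 ?gt_eqF//; last exact: lt_le_trans p1.
  by move=> nuA; apply/eqP; rewrite eq_le nuA measure_ge0.
have [c [p [c0 p0 low]]] := condition1_lower_bound _ _ _ _ _ _ dm db bmu dmu bnu dnu c1.
exists c, p%:R; split=> //; first by rewrite ler1n.
move=> x r E r0 mE EB; rewrite powR_mulrn ?divr_ge0 ?fine_ge0//.
exact: low.
Qed.
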